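(* Let $x \geq 0$ be a real number. For each positive integer $n$ and real $y$, let $A_n(y) = \frac1n \sum_{k=1}^n \frac1k \lfloor ky \rfloor$, and for $n \geq 2$ let $D_n(y) = A_n(y) - A_{n-1}(y)$. Then $$\lim_{n\to\infty} n^2 D_n\left(\tfrac1{n} x\right) = \sum_{k = 1}^{\lfloor x \rfloor} \left( 1 - \log\left(\tfrac{x}{k}\right) \right).$$
   Context: $\lfloor t \rfloor$ denotes the greatest integer less than or equal to $t$, and $\log$ is the natural logarithm. An empty sum equals $0$. *)

(* Defs.v *)
From mathcomp Require Import all_boot all_order all_algebra.
From mathcomp Require Import all_classical all_reals all_analysis.

Set Implicit Arguments.
Unset Strict Implicit.
Unset Printing Implicit Defensive.

Import Order.TTheory GRing.Theory Num.Theory.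
Import numFieldNormedType.Exports.

Local Open Scope ring_scope.

(* Only [n >= 1] is meaningful; since [0^-1 = 0], [floor_avg 0 y = 0]. *)
Definition floor_avg (R : realType) (n : nat) (y : R) : R :=
  n%:R^-1 * \sum_(1 <= k < n.+1) k%:R^-1 * (Num.floor (k%:R * y))%:~R.

(* Only [n >= 2] is meaningful; the values at [n = 0] and [n = 1] do not
   matter for limits as [n] tends to infinity. *)
Definition floor_avg_diff (R : realType) (n : nat) (y : R) : R :=
  floor_avg n y - floor_avg n.-1 y.

(* Main.v *)
Require Import Defs.
From mathcomp Require Import all_boot all_order all_algebra.
From mathcomp Require Import all_classical all_reals all_analysis.
From mathcomp Require Import ring lra.

(** Put [N = floor x] and let [S n] be the sum of [floor (k x / n) / k] over
    [1 <= k < n].  The last term of [n A_n(x / n)] is [N / n], so that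
    [A_n(x / n) = (S n + N / n) / n] and [A_{n-1}(x / n) = S n / (n - 1)].
    Hence, exactly,
      [n^2 D_n(x / n) = N - n / (n - 1) * S n],
    which is [floor_avg_diff_scaled].

    The limit of [S n] comes from a lattice-point count.  For [k < n],
    [floor (k x / n)] is the number of integers [j] with [1 <= j <= N] and
    [j <= k x / n]; exchanging the two sums ([sum_floor_exchange]) makes [S n]
    the sum over [1 <= j <= N] of the partial harmonic sums of [1 / k] over
    [(j / x) n <= k < n].  The number [N] of these harmonic sums does not
    depend on [n], and each of them is a Riemann sum of [1 / t] on
    [[j / x, 1]]: it tends to [- ln (j / x) = ln (x / j)]
    ([cvg_sum_inv_tail]).  So [n^2 D_n(x / n)] tends to
    [N - \sum_j ln (x / j)]. *)

Set Implicit Arguments.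
Unset Strict Implicit.
Unset Printing Implicit Defensive.

Import Order.TTheory GRing.Theory Num.Theory.
Import numFieldNormedType.Exports.

Local Open Scope classical_set_scope.
Local Open Scope ring_scope.

(** The upper bound [M] of the range may be any integer above [floor y]: this
    is what lets one range of [j] serve for all the [k] at once. *)
Lemma floor_count (R : realType) (y : R) (M : nat) :
  0 <= y -> Num.floor y <= M%:Z ->
  (Num.floor y)%:~R = \sum_(1 <= j < M.+1) (j%:R <= y)%R%:R :> R.
Proof.
move=> y0; case Et : (Num.floor y) => [t|t]; last first.
  by move: y0; rewrite -floor_ge0 Et.
rewrite lez_nat => tM.
have le_y j : (j%:R <= y) = (j < t.+1)%N.
  by rewrite -[j%:R]/(j%:Z%:~R) -floor_ge_int Et lez_nat.
under eq_bigr => j _ do rewrite le_y mulrb.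
rewrite -big_mkcond -(big_nat_widen 1 t.+1 M.+1 predT) //.
by rewrite big_const_nat subn1 iter_addr addr0.
Qed.

(** Both inequalities are [ln (1 + t) <= t], at [t = - 1 / (k + 1)] and at
    [t = 1 / k]. *)
Lemma inv_ln_diff (R : realType) (k : nat) : (0 < k)%N ->
  k.+1%:R^-1 <= ln k.+1%:R - ln k%:R :> R /\
  ln k.+1%:R - ln k%:R <= k%:R^-1 :> R.
Proof.
move=> k0; have kp : 0 < k%:R :> R by rewrite ltr0n.
have k1p : 0 < k.+1%:R :> R by rewrite ltr0n.
have -> : k.+1%:R = k%:R + 1 :> R by rewrite natr1.
have k1p' : 0 < k%:R + 1 :> R by lra.
split.
  have : ln (1 + - (k%:R + 1)^-1) <= - (k%:R + 1)^-1 :> R.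
    by apply: le_ln1Dx; rewrite ltrN2 invf_lt1 //; lra.
  have -> : 1 + - (k%:R + 1)^-1 = k%:R / (k%:R + 1) :> R.
    by field; apply/eqP; lra.
  by rewrite ln_div ?posrE //; lra.
have -> : ln (k%:R + 1) - ln k%:R = ln (1 + k%:R^-1) :> R.
  rewrite -ln_div ?posrE //; congr ln; field; apply/eqP; lra.
apply: le_ln1Dx; apply: (lt_trans (ltrN10 _)); by rewrite invr_gt0.
Qed.

(** Summing the bounds of [inv_ln_diff]: in both directions the comparison
    telescopes, the upper one after [1 / k] is replaced by [1 / (k + 1)] at
    the cost of [1 / m - 1 / n]. *)
Lemma sum_inv_bounds (R : realType) (m n : nat) : (0 < m <= n)%N ->
  ln n%:R - ln m%:R <= (\sum_(m <= k < n) k%:R^-1 : R)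
    <= ln n%:R - ln m%:R + m%:R^-1.
Proof.
case/andP=> m0 mn; apply/andP; split.
  rewrite -(telescope_sumr (fun k => ln k%:R : R) mn).
  apply: ler_sum_nat => k /andP[mk _].
  by case: (inv_ln_diff R (leq_trans m0 mk)).
apply: (@le_trans _ _ (ln n%:R - ln m%:R + (m%:R^-1 - n%:R^-1))); last first.
  by rewrite lerD2l gerBl invr_ge0 ler0n.
have -> : ln n%:R - ln m%:R + (m%:R^-1 - n%:R^-1)
    = (ln n%:R - n%:R^-1) - (ln m%:R - m%:R^-1) :> R by ring.
rewrite -(telescope_sumr (fun k => ln k%:R - k%:R^-1 : R) mn).
apply: ler_sum_nat => k /andP[mk _].
have [/= + _] := inv_ln_diff R (leq_trans m0 mk).
by move: k.+1%:R^-1 (ln k.+1%:R) => u v; lra.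
Qed.

(** The sum starts at [m = ceil (c n)], so it is [- ln (m / n)] up to an error
    at most [1 / m] by [sum_inv_bounds].  As [c <= m / n <= c + 1 / n], it is
    squeezed between [- ln (c + 1 / n)] and [- ln c + 1 / (c n)].  The
    hypothesis [c <= 1] ensures [m <= n]. *)
Lemma cvg_sum_inv_tail (R : realType) (c : R) : 0 < c -> c <= 1 ->
  (fun n : nat => \sum_(1 <= k < n | c * n%:R <= k%:R) k%:R^-1) @ \oo
    --> - ln c.
Proof.
move=> c0 c1.
rewrite -cvg_shiftS /=.
have hc : (fun n : nat => c + harmonic n) @ \oo --> c.
  by rewrite -[X in _ --> X]addr0; apply: cvgD; [exact: cvg_cst | exact: cvg_harmonic].
(* [harmonic n] is [1 / (n + 1)], whence the shift of the index. *)
apply: (@squeeze_cvgr _ _ _ _ (fun n => - ln (c + harmonic n))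
   (fun n => - ln c + c^-1 * harmonic n)).
- near=> n; rewrite /harmonic /=.
  set y := c * n.+1%:R.
  have n0 : 0 < n.+1%:R :> R by rewrite ltr0n.
  have y0 : 0 < y by rewrite mulr_gt0.
  have Em : (`|Num.ceil y|%N : int) = Num.ceil y.
    by rewrite gez0_abs // ltW // ceil_gt0.
  set m := `|Num.ceil y|%N in Em.
  have le_m k : (y <= k%:R) = (m <= k)%N.
    by rewrite -[k%:R]/(k%:Z%:~R) -ceil_le_int -Em lez_nat.
  have m0 : (0 < m)%N by rewrite -ltz_nat Em ceil_gt0.
  have mn : (m <= n.+1)%N by rewrite -le_m /y ler_piMl // ltW.
  have ym : y <= m%:R by rewrite le_m.
  have my : m%:R < y + 1.
    by have := ceilB1_lt y; rewrite -Em intrD mulrN1z pmulrn; lra.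
  have mp : 0 < m%:R :> R by rewrite ltr0n.
  under eq_bigl => k do rewrite le_m.
  rewrite -(big_nat_widenl _ _ _ predT) //.
  have mm : (0 < m <= n.+1)%N by rewrite m0.
  have /andP[lo hi] := sum_inv_bounds R mm.
  have Eln : ln n.+1%:R - ln m%:R = - ln (m%:R / n.+1%:R) :> R.
    by rewrite ln_div ?posrE //; ring.
  rewrite Eln in lo hi.
  have mnp : 0 < m%:R / n.+1%:R :> R by rewrite divr_gt0.
  apply/andP; split.
    apply: le_trans lo.
    rewrite lerN2 ler_ln ?posrE //; last by rewrite addr_gt0 ?invr_gt0.
    rewrite ler_pdivrMr // mulrDl mulVf ?gt_eqF //; exact: ltW.
  apply: le_trans hi _.
  apply: lerD.
    by rewrite lerN2 ler_ln ?posrE // ler_pdivlMr.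
  by rewrite -invfM lef_pV2 ?posrE.
- by apply: cvgN; exact: (continuous_cvg _ (continuous_ln c0) hc).
- rewrite -[X in _ --> X]addr0 -(mulr0 c^-1).
  by apply: cvgD; [exact: cvg_cst | apply: cvgMr; exact: cvg_harmonic].
Unshelve. all: by end_near.
Qed.

(** Counts in two ways the pairs [(k, j)] with [j <= k x / n], each with
    weight [1 / k].  Since [k < n], no [j] above [floor x] occurs. *)
Lemma sum_floor_exchange (R : realType) (x : R) (n : nat) : 0 <= x ->
  (0 < n)%N ->
  \sum_(1 <= k < n) k%:R^-1 * (Num.floor (k%:R * (n%:R^-1 * x)))%:~R =
  \sum_(1 <= j < `|Num.floor x|%N.+1)
    \sum_(1 <= k < n | j%:R / x * n%:R <= k%:R) k%:R^-1 :> R.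
Proof.
move=> x0 n0; have np : 0 < n%:R :> R by rewrite ltr0n.
transitivity (\sum_(1 <= k < n) \sum_(1 <= j < `|Num.floor x|%N.+1)
    (if j%:R / x * n%:R <= k%:R then k%:R^-1 else 0) : R); last first.
  by rewrite exchange_big; apply: eq_bigr => j _; rewrite -big_mkcond.
apply: eq_big_nat => k /andP[k0 kn].
have kp : 0 < k%:R :> R by rewrite ltr0n.
(* For [x = 0] the range of [j] is empty, so dividing by [x] is harmless. *)
have xp_of j : (1 <= j < `|Num.floor x|%N.+1)%N -> 0 < x.
  move=> /andP[j0 jx]; apply: lt_le_trans ltr01 _.
  rewrite -[1]/(1%:Z%:~R) -floor_ge_int.
  by rewrite -[Num.floor x]gez0_abs ?floor_ge0 // lez_nat (leq_trans j0).
rewrite (@floor_count _ _ `|Num.floor x|%N).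
- rewrite mulr_sumr; apply: eq_big_nat => j jr; have xp := xp_of j jr.
  have -> : (j%:R <= k%:R * (n%:R^-1 * x)) = (j%:R / x * n%:R <= k%:R).
    by rewrite mulrA -ler_pdivrMr // ler_pdivlMr.
  by case: ifP => _; rewrite ?mulr1 ?mulr0.
- by rewrite !mulr_ge0 // invr_ge0 ltW.
- rewrite gez0_abs ?floor_ge0 //; apply: le_floor.
  rewrite mulrA ler_piMl // ler_pdivrMr // mul1r ler_nat; exact: ltnW.
Qed.

(** The index is [n + 2] because the identity divides by the predecessor of
    the index; there [(n + 2) / (n + 1) = 1 + harmonic n]. *)
Lemma floor_avg_diff_scaled (R : realType) (x : R) (n : nat) :
  n.+2%:R ^+ 2 * floor_avg_diff n.+2 (n.+2%:R^-1 * x) =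
  (Num.floor x)%:~R - (1 + harmonic n) *
   \sum_(1 <= k < n.+2) k%:R^-1 * (Num.floor (k%:R * (n.+2%:R^-1 * x)))%:~R :> R.
Proof.
rewrite /floor_avg_diff /floor_avg /= /harmonic big_nat_recr //= mulVKf ?pnatr_eq0 //.
set S := \sum_(_ <= _ < _) _; set f := _%:~R.
have -> : n.+2%:R = n.+1%:R + 1 :> R by rewrite natr1.
have : 0 < n.+1%:R :> R by rewrite ltr0n.
move: n.+1%:R => a a0.
field; apply/andP; split; apply/eqP; lra.
Qed.

Theorem theorem4 (R : realType) (x : R) (hx : 0 <= x) :
  (fun n : nat => n%:R ^+ 2 * floor_avg_diff n (n%:R^-1 * x)) @ \oo -->
  \sum_(1 <= k < `|Num.floor x|%N.+1) (1 - ln (x / k%:R)).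
Proof.
set N := `|Num.floor x|%N.
pose T (n : nat) : R := \sum_(1 <= j < N.+1)
    \sum_(1 <= k < n | j%:R / x * n%:R <= k%:R) k%:R^-1.
have cvgT : T @ \oo --> (\sum_(1 <= j < N.+1) ln (x / j%:R) : R).
  (* Keep the range of [j] as a condition: it gives [j / x <= 1] below. *)
  rewrite [X in _ --> X]big_nat_cond.
  rewrite /T; under eq_fun do rewrite big_nat_cond.
  apply: cvg_big; first exact: add_continuous.
  move=> j /andP[/andP[j0 jN] _].
  have jp : 0 < j%:R :> R by rewrite ltr0n.
  have jx : j%:R <= x.
    by rewrite -[j%:R]/(j%:Z%:~R) -floor_ge_int -[Num.floor x]gez0_abs ?floor_ge0.
  have xp : 0 < x by exact: lt_le_trans jx.
  have -> : ln (x / j%:R) = - ln (j%:R / x).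
    by rewrite !ln_div ?posrE // opprB.
  by apply: cvg_sum_inv_tail; [exact: divr_gt0 | rewrite ler_pdivrMr ?mul1r].
rewrite -(cvg_shiftn 2).
have -> : [sequence (n + 2)%:R ^+ 2 * floor_avg_diff (n + 2) ((n + 2)%:R^-1 * x)]_n
   = (fun n => N%:R - (1 + harmonic n) * T (n + 2)%N).
  apply/funext => n /=; rewrite addn2 floor_avg_diff_scaled sum_floor_exchange //.
  by rewrite -[in LHS](gez0_abs (_ : 0 <= Num.floor x)) ?floor_ge0.
have -> : \sum_(1 <= k < N.+1) (1 - ln (x / k%:R)) =
    N%:R - (1 + 0) * \sum_(1 <= j < N.+1) ln (x / j%:R).
  by rewrite sumrB addr0 mul1r big_const_nat subn1 iter_addr addr0.
apply: cvgB; first exact: cvg_cst.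
apply: cvgM; last by rewrite (cvg_shiftn 2 T).
by apply: cvgD; [exact: cvg_cst | exact: cvg_harmonic].
Qed.
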